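(* Let $M$ be a smooth statistical model with parameter $\theta\in\Theta\subset\mathbb{R}^k$ and log-likelihood $\ell$, let $g$ be a generalized estimator with values in $\mathbb{R}^{k}$, and write $$\Lambda(g)=C^{t}\,V(g)^{-1}\,C,\qquad C_{ij}=\mathrm{Cov}(g_i,\partial_j\ell)=-E\left(\frac{\partial g_i}{\partial\theta_j}\right).$$ Then: (i) for any invertible matrix function $A(\theta)$ (with values in the $k\times k$ matrices), $\Lambda(A(\theta)\,g)=\Lambda(g)$; (ii) under a reparameterization $\xi=\tau(\theta)$ with Jacobian $J=\partial\theta/\partial\xi$, $\Lambda$ and the Fisher information transform identically, $\Lambda_{\xi}=J^{t}\Lambda_{\theta}J$ and $I_{\xi}=J^{t}I_{\theta}J$, so that the eigenvalues of $\mathrm{Eff}^{\Lambda}(g)=I^{-1/2}\Lambda(g)I^{-1/2}$, and in particular the scalar efficiency $\mathrm{tr}\,\mathrm{Eff}^{\Lambda}(g)$, do not depend on the parameterization.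
   Context: $M$ is a family of probability distributions on $\mathcal{Y}$ with common support, having densities with respect to a dominating measure, which is a smooth manifold with a global parameterization $\theta_M:M\to\Theta$, a diffeomorphism onto an open set $\Theta\subset\mathbb{R}^k$. A reparameterization is $\xi=\tau(\theta)$ with $\tau$ a diffeomorphism from $\Theta$ onto an open subset of $\mathbb{R}^k$. $\ell(y,\theta)$ is the log of the density at $y$ of the distribution with parameter $\theta$; $\partial_j\ell=\partial\ell/\partial\theta_j$. Usual regularity is assumed: the score $\nabla_\theta\ell$ has mean zero and is square-integrable at each $\theta$, and the Fisher information matrix $I_\theta=E_\theta(\nabla_\theta\ell\,\nabla_\theta\ell^{t})$ is invertible. A generalized estimator with values in $\mathbb{R}^k$ is a function $g:\mathcal{Y}\times\Theta\to\mathbb{R}^k$ with $E_\theta(g(\cdot,\theta))=0$ for all $\theta$, square-integrable at each $\theta$, and smooth in $\theta$, with differentiation under the integral permitted (so that $\mathrm{Cov}(g_i,\partial_j\ell)=-E(\partial g_i/\partial\theta_j)$). $E$, $\mathrm{Cov}$ and $V$ (the covariance matrix) are computed at the distribution labelled $\theta$, so $\Lambda(g)$ and $I$ are matrix functions of the parameter; $V(g)$ is assumed invertible. For $A(\theta)g$, $\Lambda$ is computed with $C$ given by the covariance formula $C_{ij}=\mathrm{Cov}((Ag)_i,\partial_j\ell)$. $\Lambda_\theta,I_\theta$ denote these matrices computed in the $\theta$ parameterization, and $\Lambda_\xi,I_\xi$ those computed in the $\xi$ parameterization at the same distribution, where $g$ is regarded as a fixed function on $\mathcal{Y}\times M$ expressed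 in the respective coordinates and derivatives of $\ell$ are taken with respect to the respective parameter. *)

(* Defs.v *)
From HB Require Import structures.
From mathcomp Require Import all_boot all_order all_algebra.
From mathcomp Require Import all_classical all_reals all_analysis.

Set Implicit Arguments.
Unset Strict Implicit.
Unset Printing Implicit Defensive.

Import Order.TTheory GRing.Theory Num.Theory.
Import numFieldNormedType.Exports.

Local Open Scope classical_set_scope.
Local Open Scope ring_scope.

Section smooth_functions.
Context {R : realType} {k : nat}.
Implicit Types (U V : set 'rV[R]_k).

Definition pderiv (f : 'rV[R]_k -> R) (j : 'I_k) (x : 'rV[R]_k) : R :=
  'D_(delta_mx 0 j) f x.

(* Meant for open [U]: the values of [f] outside [U] are then irrelevant. *)
Fixpoint Cn_on (n : nat) U (f : 'rV[R]_k -> R) : Prop :=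
  match n with
  | 0%N => forall x, U x -> {for x, continuous f}
  | n'.+1 => (forall x, U x -> differentiable f x) /\
             (forall j, Cn_on n' U (pderiv f j))
  end.

Definition smooth_on U (f : 'rV[R]_k -> R) : Prop := forall n, Cn_on n U f.

Definition smooth_map_on U (f : 'rV[R]_k -> 'rV[R]_k) : Prop :=
  forall i : 'I_k, smooth_on U (fun x => f x 0 i).

Definition diffeomorphism U V (f : 'rV[R]_k -> 'rV[R]_k) : Prop :=
  [/\ open U, open V, set_bij U V f, smooth_map_on U f &
      exists2 h : 'rV[R]_k -> 'rV[R]_k,
        smooth_map_on V h & forall x, U x -> h (f x) = x].

End smooth_functions.

Section inverse_square_root.
Context {R : realType} {k : nat}.

Definition sym_posdef (S : 'M[R]_k) : Prop :=
  S^T = S /\ forall u : 'rV[R]_k, u != 0 -> 0 < (u *m S *m u^T) 0 0.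

(* I^{-1/2}: the symmetric positive definite square root of I^{-1}. It exists
   and is unique when I is symmetric positive definite; the default value 0 is
   only taken otherwise. *)
Definition invsqrtmx (I : 'M[R]_k) : 'M[R]_k :=
  xget 0 [set S : 'M[R]_k | sym_posdef S /\ S *m S = invmx I].

End inverse_square_root.

Section statistical_models.
Context {d : measure_display} {Y : measurableType d} {R : realType} {k : nat}.
Implicit Types (M : set (probability Y R)) (P Q : probability Y R).

(* The coordinates [chart_coord P] of a distribution P, and conversely the
   distribution [chart_label x] whose coordinates are x in [chart_dom]. *)
Record chart := Chart {
  chart_dom : set 'rV[R]_k ;
  chart_coord : probability Y R -> 'rV[R]_k ;
  chart_label : 'rV[R]_k -> probability Y R }.

(* The manifold structure of M is the one transported by such a chart, so that
   smoothness on M is smoothness in the coordinates. *)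
Record global_parameterization M (c : chart) : Prop := {
  dom_open : open (chart_dom c) ;
  coord_dom : forall P, M P -> chart_dom c (chart_coord c P) ;
  label_in : forall x, chart_dom c x -> M (chart_label c x) ;
  coordK : forall P, M P -> chart_label c (chart_coord c P) = P ;
  labelK : forall x, chart_dom c x -> chart_coord c (chart_label c x) = x }.

Definition reparameterization M (c c' : chart)
    (tau : 'rV[R]_k -> 'rV[R]_k) : Prop :=
  [/\ global_parameterization M c',
      diffeomorphism (chart_dom c) (chart_dom c') tau &
      forall P, M P -> chart_coord c' P = tau (chart_coord c P)].

(* The matrix of the partial derivatives d theta_i / d xi_j at P, where
   theta = chart_coord c and xi = chart_coord c'. The library's Jacobian acts
   on row vectors, whence the transposition. *)
Definition change_jacobian (c c' : chart) P : 'M[R]_k :=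
  ('J (fun x => chart_coord c (chart_label c' x)) (chart_coord c' P))^T.

Definition is_density (mu : {measure set Y -> \bar R}) M
    (p : probability Y R -> Y -> R) : Prop :=
  forall P, M P ->
    [/\ measurable_fun setT (p P), forall y, 0 <= p P y &
        forall A, measurable A -> P A = (\int[mu]_(y in A) (p P y)%:E)%E].

Definition common_support M (p : probability Y R -> Y -> R) : Prop :=
  forall P Q, M P -> M Q -> forall y, 0 < p P y <-> 0 < p Q y.

Definition loglik (p : probability Y R -> Y -> R) (c : chart)
    (y : Y) (x : 'rV[R]_k) : R := ln (p (chart_label c x) y).

(* Off the common support, a null set for every member of the model, [loglik]
   is constant since [ln 0 = 0], and the score vanishes. *)
Definition score (p : probability Y R -> Y -> R) (c : chart) P
    (j : 'I_k) (y : Y) : R := pderiv (loglik p c y) j (chart_coord c P).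

Definition fisher (p : probability Y R -> Y -> R) (c : chart) P : 'M[R]_k :=
  \matrix_(i, j) fine ('E_P[score p c P i \* score p c P j])%E.

Record regular_model (mu : {measure set Y -> \bar R}) M
    (p : probability Y R -> Y -> R) (c : chart) : Prop := {
  model_param : global_parameterization M c ;
  model_density : is_density mu M p ;
  model_support : common_support M p ;
  loglik_smooth : forall P y, M P -> 0 < p P y ->
    smooth_on (chart_dom c) (loglik p c y) ;
  score_L2 : forall P j, M P -> score p c P j \in Lfun P 2%:E ;
  score_mean0 : forall P j, M P -> ('E_P[score p c P j] = 0)%E ;
  fisher_unit : forall P, M P -> fisher p c P \in unitmx }.

(* Functions on Y x M with values in R^k, seen as g P y with P in M. *)
Implicit Types (g : probability Y R -> Y -> 'cV[R]_k).

Definition gcomp g P (i : 'I_k) (y : Y) : R := g P y i 0.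

Definition covmx g P : 'M[R]_k :=
  \matrix_(i, j) fine (covariance P (gcomp g P i) (gcomp g P j)).

Definition crosscov (p : probability Y R -> Y -> R) (c : chart) g P :
    'M[R]_k :=
  \matrix_(i, j) fine (covariance P (gcomp g P i) (score p c P j)).

Definition mean_deriv (c : chart) g P : 'M[R]_k :=
  \matrix_(i, j)
    fine ('E_P[fun y => pderiv (fun x => gcomp g (chart_label c x) i y) j
                          (chart_coord c P)])%E.

Definition Lambda (p : probability Y R -> Y -> R) (c : chart) g P : 'M[R]_k :=
  (crosscov p c g P)^T *m invmx (covmx g P) *m crosscov p c g P.

Definition Eff (p : probability Y R -> Y -> R) (c : chart) g P : 'M[R]_k :=
  invsqrtmx (fisher p c P) *m Lambda p c g P *m invsqrtmx (fisher p c P).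

(* E_theta g_i(., theta) is the integral of g_i p against mu; its derivatives in
   the coordinates may be computed under the integral sign. *)
Definition diff_under_integral (mu : {measure set Y -> \bar R}) M
    (p : probability Y R -> Y -> R) (c : chart) g : Prop :=
  forall P (i j : 'I_k), M P ->
    let h (x : 'rV[R]_k) (y : Y) :=
      gcomp g (chart_label c x) i y * p (chart_label c x) y in
    [/\ mu.-integrable setT (fun y => (pderiv (h^~ y) j (chart_coord c P))%:E),
        derivable (fun x => \int[mu]_y h x y) (chart_coord c P) (delta_mx 0 j) &
        pderiv (fun x => \int[mu]_y h x y) j (chart_coord c P) =
        \int[mu]_y pderiv (h^~ y) j (chart_coord c P)].

Record generalized_estimator (mu : {measure set Y -> \bar R}) M
    (p : probability Y R -> Y -> R) (c : chart) g : Prop := {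
  est_L2 : forall P i, M P -> gcomp g P i \in Lfun P 2%:E ;
  est_mean0 : forall P i, M P -> ('E_P[gcomp g P i] = 0)%E ;
  est_smooth : forall y i,
    smooth_on (chart_dom c) (fun x => gcomp g (chart_label c x) i y) ;
  est_diff_under : diff_under_integral mu M p c g ;
  est_covmx_unit : forall P, M P -> covmx g P \in unitmx }.

End statistical_models.

Arguments chart {d} Y R k.

(* Main.v *)
Require Import Defs.
From HB Require Import structures.
From mathcomp Require Import all_boot all_order all_algebra.
From mathcomp Require Import all_classical all_reals all_analysis.
From mathcomp Require Import measurable_realfun complex.

Set Implicit Arguments.
Unset Strict Implicit.
Unset Printing Implicit Defensive.

Import Order.TTheory GRing.Theory Num.Theory.
Import numFieldNormedType.Exports.

Local Open Scope classical_set_scope.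
Local Open Scope ring_scope.

(** Everything reduces to the bilinearity of second moments. The components of
    g and of the score are centered and square-integrable, so that V(g), C and
    the Fisher information I are matrices of moments E(X_i Z_j) ([moment]), and
    replacing X by A X and Z by B Z turns such a matrix N into A N B^t
    ([moment_lincomb]).

    - For g replaced by A g this gives C -> A C and V -> A V A^t, and A cancels
      in C^t V^-1 C ([Lambda_mulmx]).

    - Under a change of chart, the chain rule expresses the xi-score as J^t
      applied to the theta-score ([score_chart]), whence C -> C J and
      I -> J^t I J, while V is unchanged. Hence Lambda -> J^t Lambda J.

    - If S is a symmetric square root of I^-1, then S Lambda S is similar to
      Lambda S S = Lambda I^-1. Under Lambda -> J^t Lambda J and I -> J^t I J
      the latter is conjugated by J^t, as J is invertible. So the matrices Eff
      in the two charts are similar and share characteristic polynomial,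
      eigenvalues and trace ([Eff_chart]). This needs a square root of I^-1 to
      exist, which is the spectral theorem for a real symmetric matrix
      ([exists_posdef_sqrtmx]).

    - For C = - E(dg), the integral of g_i p against mu is identically 0 in
      theta; differentiating under the integral sign gives
      0 = E(d_j g_i + g_i d_j l), because d_j p = p d_j l on the support
      ([pderiv_estimator_density]). The two terms may be separated since
      g_i d_j l is integrable, which makes d_j g_i integrable too. In the chart
      xi both sides are multiplied by J on the right. *)

(** * Square roots and congruence of symmetric matrices *)

Lemma exists_interpolation (F : fieldType) (h : F -> F) (s : seq F) :
  exists r : {poly F}, forall x, x \in s -> r.[x] = h x.
Proof.
elim: s => [|x s [r rh]]; first by exists 0.
have [xs|xs] := boolP (x \in s).
  by exists r => y; rewrite inE => /predU1P[->|]; exact: rh.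
pose w := \prod_(z <- s) ('X - z%:P).
have wx : w.[x] != 0 by rewrite -[_ == 0]/(root w x) root_prod_XsubC.
exists (r + ((h x - r.[x]) / w.[x]) *: w) => y.
rewrite inE hornerD hornerZ => /predU1P[->|ys].
  by rewrite divfK// addrC subrK.
have /rootP -> : root w y by rewrite root_prod_XsubC.
by rewrite mulr0 addr0 rh.
Qed.

Lemma tr_horner_mx (R : comNzRingType) (n : nat) (A : 'M[R]_n.+1)
    (q : {poly R}) : A^T = A -> (horner_mx A q)^T = horner_mx A q.
Proof.
move=> AT; elim/poly_ind: q => [|q c IH]; first by rewrite rmorph0 trmx0.
rewrite rmorphD rmorphM/= horner_mx_X horner_mx_C linearD/= tr_scalar_mx.
rewrite [X in X + _ = _]trmx_mul AT IH; congr (_ + _).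
exact/esym/comm_horner_mx.
Qed.

(** Over R[i] the matrix is hermitian, hence diagonal in a unitary basis with
    real diagonal entries; these form [s]. Since the entries are real, a real
    polynomial that vanishes on them annihilates the matrix over R[i], hence
    over R. Annihilation of A by polynomials is the form of diagonalizability
    that descends from R[i] to R without choosing a real eigenbasis. *)
Lemma symmetric_real_spectrum (R : rcfType) (n : nat) (A : 'M[R]_n.+1) :
  A^T = A -> exists s : seq R, {in s, forall a, eigenvalue A a} /\
    forall p : {poly R}, {in s, forall a, root p a} -> horner_mx A p = 0.
Proof.
move=> AT.
pose f : {rmorphism R -> R[i]} := real_complex R.
pose B := map_mx f A.
have Bherm : B \is hermsymmx.
  apply: realsym_hermsym.
    by apply/is_hermitianmxP; rewrite expr0 scale1r map_mx_id// /B map_trmx AT.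
  by apply/mxOverP => i j; rewrite mxE complex_real.
pose U := spectralmx B; pose D := spectral_diag B.
have Uu : U \in unitmx := spectral_unit B.
have BE : B = invmx U *m diag_mx D *m U.
  exact/orthomx_spectralP/hermitian_normalmx.
pose c i : R := complex.Re (D 0 i).
have cE i : D 0 i = f (c i).
  have /mxOverP/(_ 0 i) := hermitian_spectral_diag_real Bherm.
  by move=> /RRe_real.
exists [seq c i | i : 'I_n.+1]; split.
  move=> _ /mapP[i _ ->].
  rewrite -(eigenvalue_map f); apply/eigenvalueP; exists (row i U).
    rewrite -row_mul -/B BE !mulmxA mulmxV// mul1mx.
    by rewrite row_mul row_diag_mx -scalemxAl -rowE cE.
  apply: contraTneq Uu => Ui0; rewrite -row_free_unit.
  apply/negP => /row_freeP[V] /(congr1 (row i)).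
  rewrite row_mul Ui0 mul0mx => /rowP/(_ i).
  by rewrite !mxE eqxx => /esym/eqP; rewrite oner_eq0.
move=> p p0; apply: (map_mx_inj (f := f)); rewrite map_mx0.
have -> : map_mx f (horner_mx A p) = horner_mx B (map_poly f p).
  exact: map_horner_mx.
rewrite BE (horner_mx_uconjC _ _ Uu) horner_mx_diag.
suff -> : map_mx (horner (map_poly f p)) D = 0.
  by rewrite linear0 mulmx0 mul0mx.
apply/rowP => i; rewrite !mxE cE horner_map.
by rewrite (rootP (p0 _ (map_f _ _))) ?rmorph0// mem_enum.
Qed.

(** The eigenvalues a are nonnegative. If the polynomial r interpolates
    a |-> a^(1/4) on them, then r ^ 4 - X vanishes on the spectrum, so
    T = r(A) is a symmetric fourth root of A, and S = T^2 is a square root.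
    Passing through the fourth root makes the positivity of S immediate:
    u S u^t = (u T) (u T)^t. *)
Lemma exists_posdef_sqrtmx (R : realType) (n : nat) (A : 'M[R]_n) :
  A^T = A -> (forall u : 'rV[R]_n, 0 <= (u *m A *m u^T) 0 0) ->
  A \in unitmx -> exists S : 'M[R]_n, sym_posdef S /\ S *m S = A.
Proof.
case: n A => [|n] A AT Apos Au.
  (* [horner_mx] is only defined for matrices of positive size. *)
  exists 0; split; last by apply/matrixP => -[].
  by split=> [|u]; [rewrite trmx0|rewrite thinmx0 eqxx].
have dot_gt0 (u : 'rV[R]_n.+1) : u != 0 -> 0 < (u *m u^T) 0 0.
  have -> : (u *m u^T) 0 0 = \sum_i u 0 i ^+ 2.
    by rewrite mxE; apply: eq_bigr => i _; rewrite mxE expr2.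
  move=> u0; rewrite lt_def sumr_ge0 ?andbT; last by move=> *; exact: sqr_ge0.
  apply: contra u0; rewrite psumr_eq0; last by move=> *; exact: sqr_ge0.
  move=> /allP u0; apply/eqP/rowP => i; rewrite mxE; apply/eqP.
  by rewrite -sqrf_eq0; apply: u0; rewrite mem_index_enum.
have eig_ge0 a : eigenvalue A a -> 0 <= a.
  move=> /eigenvalueP[u uA u0]; have := Apos u.
  by rewrite uA -scalemxAl mxE pmulr_lge0// dot_gt0.
have [s [seig sA]] := symmetric_real_spectrum AT.
have [r rE] := exists_interpolation (fun a => Num.sqrt (Num.sqrt a)) s.
pose T := horner_mx A r.
have TT : T^T = T by exact: tr_horner_mx.
have T4 : T *m T *m (T *m T) = A.
  have -> : T *m T *m (T *m T) = horner_mx A (r * r * (r * r)).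
    by rewrite !rmorphM.
  apply/eqP; rewrite -subr_eq0 -[X in _ - X]horner_mx_X -rmorphB /=.
  rewrite sA// => a sa.
  rewrite /root !hornerE rE//= -mulrA -!expr2 sqr_sqrtr ?sqrtr_ge0//.
  by rewrite sqr_sqrtr ?subrr// eig_ge0// seig.
have Tu : T \in unitmx by move: Au; rewrite -T4 -mulmxA unitmx_mul => /andP[].
exists (T *m T); split=> //; split=> [|u u0]; first by rewrite trmx_mul TT.
have -> : u *m (T *m T) *m u^T = u *m T *m (u *m T)^T.
  by rewrite trmx_mul TT !mulmxA.
rewrite dot_gt0//; apply: contra u0 => /eqP uT0.
by rewrite -[u](mulmxK Tu) uT0 mul0mx.
Qed.

Lemma similar_spectrum (F : fieldType) (n : nat) (B E E' : 'M[F]_n) :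
  B \in unitmx -> E' = B *m E *m invmx B ->
  [/\ char_poly E' = char_poly E,
      forall a, eigenvalue E' a = eigenvalue E a & \tr E' = \tr E].
Proof.
move=> Bu ->.
have chE : char_poly (B *m E *m invmx B) = char_poly E.
  pose f : {rmorphism F -> {poly F}} := polyC.
  rewrite /char_poly; have -> : char_poly_mx (B *m E *m invmx B) =
      map_mx f B *m char_poly_mx E *m map_mx f (invmx B).
    rewrite /char_poly_mx !map_mxM mulmxBr mulmxBl; congr (_ - _).
    by rewrite scalar_mxC -mulmxA -map_mxM mulmxV// map_mx1 mulmx1.
  by rewrite !det_mulmx mulrAC -det_mulmx -map_mxM mulmxV// map_mx1 det1 mul1r.
split=> //; first by move=> a; rewrite !eigenvalue_root_char chE.
by rewrite mxtrace_mulC mulmxA mulVmx// mul1mx.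
Qed.

Lemma invmx_mul (R : comUnitRingType) (n : nat) (A B : 'M[R]_n) :
  A \in unitmx -> B \in unitmx -> invmx (A *m B) = invmx B *m invmx A.
Proof.
move=> Au Bu; have ABu : A *m B \in unitmx by rewrite unitmx_mul Au.
by rewrite -[RHS](mulmxK ABu) !mulmxA mulmxKV// mulVmx// mul1mx.
Qed.

Lemma invsqrtmxP (R : realType) (n : nat) (F : 'M[R]_n) :
  F^T = F -> (forall u : 'rV[R]_n, 0 <= (u *m F *m u^T) 0 0) ->
  F \in unitmx ->
  invsqrtmx F \in unitmx /\ invsqrtmx F *m invsqrtmx F = invmx F.
Proof.
move=> FT Fpos Fu.
have iFT : (invmx F)^T = invmx F by rewrite trmx_inv FT.
have iFpos (u : 'rV[R]_n) : 0 <= (u *m invmx F *m u^T) 0 0.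
  have := Fpos (u *m invmx F).
  by rewrite trmx_mul iFT !mulmxA mulmxKV.
have [|S [Spos SS]] := exists_posdef_sqrtmx iFT iFpos.
  by rewrite unitmx_inv.
have [_ SE] : sym_posdef (invsqrtmx F) /\ invsqrtmx F *m invsqrtmx F = invmx F.
  by apply: (@xgetPex _ 0 [set S | sym_posdef S /\ S *m S = invmx F]); exists S.
split=> //; have : invmx F \in unitmx by rewrite unitmx_inv.
by rewrite -SE unitmx_mul => /andP[].
Qed.

(** S' (J^t L J) S' is similar to (J^t L J) S' S' = J^t (L F^-1) J^-t, and
    S L S to L S S = L F^-1. Composing the two similarities with J^t gives the
    matrix B = S' J^t S^-1. *)
Lemma congruence_similar (K : fieldType) (n : nat) (F L J S S' : 'M[K]_n) :
  F \in unitmx -> J \in unitmx -> S \in unitmx -> S' \in unitmx ->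
  S *m S = invmx F -> S' *m S' = invmx (J^T *m F *m J) ->
  exists2 B, B \in unitmx &
    S' *m (J^T *m L *m J) *m S' = B *m (S *m L *m S) *m invmx B.
Proof.
move=> Fu Ju Su Su' SS SS'; exists (S' *m J^T *m invmx S).
  by rewrite !unitmx_mul unitmx_inv unitmx_tr Su Su' Ju.
(* Right multiplication by S' makes its square appear on the left-hand side. *)
rewrite -[LHS](mulmxK Su') -[RHS](mulmxK Su').
apply: (congr1 (mulmx^~ _)).
have SS'E : S' *m S' = invmx J *m (S *m S) *m invmx J^T.
  by rewrite SS' SS !invmx_mul ?unitmx_mul ?unitmx_tr ?Ju ?Fu// mulmxA.
rewrite -[LHS]mulmxA SS'E.
rewrite !invmx_mul ?unitmx_mul ?unitmx_inv ?unitmx_tr ?Su ?Su' ?Ju//.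
by rewrite invmxK !mulmxA !mulmxKV// mulmxK// mulmxKV.
Qed.

(** * Integration against a density *)

Section density.
Context {d : measure_display} {Y : measurableType d} {R : realType}.
Variables (mu nu : {measure set Y -> \bar R}) (p : Y -> R).
Hypothesis mp : measurable_fun setT p.
Hypothesis p_ge0 : forall y, 0 <= p y.
Hypothesis nuE :
  forall A, measurable A -> nu A = (\int[mu]_(y in A) (p y)%:E)%E.
Local Open Scope ereal_scope.
Import HBNNSimple.

Lemma integral_density_nnsfun (h : {nnsfun Y >-> R}) :
  \int[nu]_y (h y)%:E = \int[mu]_y ((h y)%:E * (p y)%:E).
Proof.
rewrite integralT_nnsfun sintegralE.
transitivity (\int[mu]_y
    (\sum_(r \in range h) (r * \1_(h @^-1` [set r]) y)%:E * (p y)%:E));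
  last first.
  apply: eq_integral => y _.
  rewrite fimfunE -fsumEFin// ge0_mule_fsuml// => r.
  exact: nnfun_muleindic_ge0.
rewrite ge0_integral_fsum//=; first last.
- by move=> r y _; rewrite mule_ge0 ?lee_fin//; exact: nnfun_muleindic_ge0.
- move=> r; apply/emeasurable_funM; apply/measurable_EFinP => //.
  by apply: measurable_funM.
apply: eq_fsbigr => r rh.
have r0 : (0 <= r)%R by move: rh; rewrite inE => -[y _ <-].
have mA : measurable (h @^-1` [set r]) by exact: measurable_sfunP.
rewrite nuE// integral_mkcond -ge0_integralZl//=; first last.
- by move=> y _; rewrite patchE; case: ifP => // _; rewrite lee_fin.
- apply/(measurable_restrictT _ _).1 => //.
  exact/measurable_EFinP/measurable_funTS.
apply: eq_integral => y _.
by rewrite epatch_indic/= EFinM -muleA; congr (_ * _); rewrite muleC.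
Qed.

(** As mu may fail to be sigma-finite, the Radon-Nikodym theory does not apply;
    the identity is extended from simple functions by monotone convergence. *)
Lemma ge0_integral_density (f : Y -> \bar R) :
  measurable_fun setT f -> (forall y, 0 <= f y) ->
  \int[nu]_y f y = \int[mu]_y (f y * (p y)%:E).
Proof.
move=> mf f0; pose h := nnsfun_approx measurableT mf.
have hf y : (h n y)%:E @[n --> \oo] --> f y by exact: cvg_nnsfun_approx.
have hnd y : {homo (fun n => (h n y)%:E) : m n / (m <= n)%N >-> m <= n}.
  by move=> m n mn; rewrite lee_fin; exact/lefP/nd_nnsfun_approx.
transitivity (limn (fun n => \int[nu]_y (h n y)%:E)).
  rewrite -monotone_convergence//; first last.
  - by move=> n y _; rewrite lee_fin.
  - by move=> n; exact/measurable_EFinP.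
  by apply: eq_integral => y _; exact/esym/cvg_lim.
rewrite (_ : (fun n => _) = fun n => \int[mu]_y ((h n y)%:E * (p y)%:E));
  last first.
  by apply/funext => n; exact: integral_density_nnsfun.
rewrite -monotone_convergence//; first last.
- by move=> y _ m n mn; rewrite lee_wpmul2r ?lee_fin// -lee_fin hnd.
- by move=> n y _; rewrite mule_ge0 ?lee_fin.
- by move=> n; apply: emeasurable_funM; exact/measurable_EFinP.
apply: eq_integral => y _; apply/cvg_lim => //.
exact: cvgeZr (hf y).
Qed.

Lemma integrable_density (f : Y -> R) : measurable_fun setT f ->
  mu.-integrable setT (fun y => (f y * p y)%:E) ->
  nu.-integrable setT (EFin \o f).
Proof.
move=> mf /integrableP[_ fp]; apply/integrableP; split.
  exact/measurable_EFinP.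
rewrite ge0_integral_density//; last first.
  by apply: measurableT_comp => //; exact/measurable_EFinP.
apply: le_lt_trans fp; rewrite le_eqVlt; apply/orP; left; apply/eqP.
by apply: eq_integral => y _ /=; rewrite normrM (ger0_norm (p_ge0 y)).
Qed.

Lemma density_integrable (f : Y -> R) :
  nu.-integrable setT (EFin \o f) ->
  mu.-integrable setT (fun y => (f y * p y)%:E).
Proof.
move=> /integrableP[mf fnu]; apply/integrableP; split.
  by apply/measurable_EFinP/measurable_funM => //; exact/measurable_EFinP.
move: fnu; rewrite ge0_integral_density//; last exact: measurableT_comp.
apply: le_lt_trans; rewrite le_eqVlt; apply/orP; left; apply/eqP.
by apply: eq_integral => y _ /=; rewrite normrM (ger0_norm (p_ge0 y)).
Qed.

(** Since p is nonnegative, the positive and negative parts of f p are f^+ p and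
    f^- p, and both integrals are defined as differences of such parts. *)
Lemma integral_density (f : Y -> R) : measurable_fun setT f ->
  \int[nu]_y (f y)%:E = \int[mu]_y (f y * p y)%:E.
Proof.
move=> mf; rewrite integralE [RHS]integralE.
have mEf : measurable_fun setT (EFin \o f) by exact/measurable_EFinP.
rewrite !ge0_integral_density//; last 2 first.
- exact: measurable_funeneg.
- exact: measurable_funepos.
congr (_ - _); apply: eq_integral => y _.
  by rewrite !funeposE/= -!EFin_max -EFinM maxr_pMl ?mul0r.
by rewrite !funenegE/= -!EFin_max -EFinM maxr_pMl ?mul0r ?mulNr.
Qed.

End density.

(** * Partial derivatives *)

Lemma near_eq_differentiable (R : numFieldType) (V W : normedModType R)
    (f g : V -> W) (a : V) :
  {near a, f =1 g} -> differentiable f a -> differentiable g a.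
Proof.
move=> fg df.
have fga : f a = g a by exact: (nbhs_singleton fg).
have dg : g \o shift a = cst (g a) + 'd f a +o_ 0 id.
  have /eqaddoP fo := diff_locally df.
  apply/eqaddoP => e e0; near=> h.
  have -> : (g \o shift a - (cst (g a) + 'd f a)) h =
            (f \o shift a - (cst (f a) + 'd f a)) h.
    rewrite !fctE fga; congr (_ - _); apply/esym; near: h.
    by rewrite [\forall h \near _, _](near_shift a) sub0r; near=> x;
      rewrite /= subrK; near: x.
  by near: h; exact: fo.
apply/diff_locallyP.
rewrite (diff_unique (diff_continuous df) dg); split=> //.
exact: diff_continuous.
Unshelve. all: by end_near. Qed.

Lemma differentiable_row (R : realType) (V : normedModType R) (n : nat)
    (f : V -> 'rV[R]_n) (a : V) :
  (forall i, differentiable (fun x => f x 0 i) a) -> differentiable f a.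
Proof.
move=> df; rewrite (_ : f = \sum_i fun x => f x 0 i *: delta_mx 0 i).
  by apply: differentiable_sum => i; exact: differentiableZl.
by apply/funext => x; rewrite fct_sumE [LHS]row_sum_delta.
Qed.

Section gradient.
Context {R : realType} {k : nat}.
Implicit Types (f : 'rV[R]_k -> R) (phi : 'rV[R]_k -> 'rV[R]_k).
Implicit Types (U : set 'rV[R]_k).

Lemma smooth_on_differentiable U f x :
  smooth_on U f -> U x -> differentiable f x.
Proof. by move=> /(_ 1%N)[+ _]; exact. Qed.

Lemma smooth_map_on_differentiable U phi x :
  smooth_map_on U phi -> U x -> differentiable phi x.
Proof.
move=> sphi Ux; apply: differentiable_row => i.
exact: (smooth_on_differentiable (sphi i) Ux).
Qed.

Lemma pderiv_comp f phi j x :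
  differentiable phi x -> differentiable f (phi x) ->
  pderiv (f \o phi) j x = \sum_l ('J phi x) j l * pderiv f l (phi x).
Proof.
move=> dphi df; rewrite /pderiv deriveE; last exact: differentiable_comp.
rewrite diff_comp//= -[X in 'd f _ X]deriveE// deriveEjacobian// -rowE.
rewrite [X in 'd f _ X]row_sum_delta linear_sum; apply: eq_bigr => l _.
by rewrite linearZ/= mxE deriveE.
Qed.

Lemma pderiv_near f g j x :
  (\forall z \near x, f z = g z) -> pderiv f j x = pderiv g j x.
Proof. exact: near_eq_derive. Qed.

Lemma pderiv_near0 f j x : (\forall z \near x, f z = 0) -> pderiv f j x = 0.
Proof. by move=> /(@pderiv_near _ (cst 0)) ->; exact: derive_cst. Qed.

(** Jacobians act on row vectors on the right, so the inner map comes first. *)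
Lemma jacobian_left_inverse phi psi x :
  differentiable psi x -> differentiable phi (psi x) ->
  (\forall z \near x, phi (psi z) = z) ->
  'J psi x *m 'J phi (psi x) = 1%:M.
Proof.
move=> dpsi dphi phiK; apply/row_matrixP => i.
rewrite rowE [RHS]rowE mulmx1 mulmxA !mul_rV_lin1.
rewrite -[LHS]/(('d phi (psi x) \o 'd psi x) _) -diff_comp// -deriveE;
  last exact: differentiable_comp.
by rewrite -[RHS](derive_id x); exact: near_eq_derive.
Qed.

(** With l a log-density: the logarithmic derivative of the density turns the
    derivative of f p into (f' + f l') p. *)
Lemma pderiv_mul_expR f l j x : differentiable f x -> differentiable l x ->
  pderiv (fun z => f z * expR (l z)) j x =
  (pderiv f j x + f x * pderiv l j x) * expR (l x).
Proof.
move=> df dl; have dexp : differentiable expR (l x).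
  by apply/derivable1_diffP; exact: derivable_expR.
have dexpl : differentiable (expR \o l) x by exact: differentiable_comp.
rewrite /pderiv (@deriveM _ _ f (expR \o l)); try exact: diff_derivable.
rewrite [X in _ *: X + _]deriveE// diff_comp//= diff1E// derive1E.
rewrite derive_val -deriveE// /GRing.scale /=.
by rewrite mulrDl addrC mulrA [expR _ * _]mulrC.
Qed.

End gradient.

(** The partial derivative is the limit of the difference quotients with step
    1/(n+1). These are only known to be measurable once the perturbed point lies
    in U, so the earlier ones are replaced with 0. *)
Lemma measurable_pderiv (d : measure_display) (Y : measurableType d)
    (R : realType) (k : nat) (U : set 'rV[R]_k) (f : 'rV[R]_k -> Y -> R)
    (j : 'I_k) (x : 'rV[R]_k) :
  open U -> U x -> (forall z, U z -> measurable_fun setT (f z)) ->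
  (forall y, derivable (f^~ y) x (delta_mx 0 j)) ->
  measurable_fun setT (fun y => pderiv (f^~ y) j x).
Proof.
move=> oU Ux mf df; pose v : 'rV[R]_k := delta_mx 0 j.
pose t (n : nat) : R := n.+1%:R^-1.
pose q n y := if `[< U (t n *: v + x) >] then
  (t n)^-1 * (f (t n *: v + x) y - f x y) else 0.
have t0 : t n @[n --> \oo] --> (0 : R) by exact: cvg_harmonic.
have tU : \forall n \near \oo, U (t n *: v + x).
  have : t n *: v + x @[n --> \oo] --> (0 *: v + x).
    by apply: cvgD; [apply: cvgZr_tmp|exact: cvg_cst].
  by rewrite scale0r add0r; apply; exact: open_nbhs_nbhs.
apply: (@measurable_fun_cvg _ _ _ _ q) => [n|y _].
  rewrite /q; case: asboolP => [Un|_]; last exact: measurable_cst.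
  by apply: measurable_funM => //; apply: measurable_funB; exact: mf.
have : (t n)^-1 * (f (t n *: v + x) y - f x y) @[n --> \oo] -->
    pderiv (f^~ y) j x.
  have /cvgr_dnbhsP/(_ t) := df y.
  by apply; split=> // n; rewrite invr_eq0 pnatr_eq0.
apply: cvg_trans; apply: near_eq_cvg; near=> n; rewrite /q ifT//.
by apply/asboolP; near: n.
Unshelve. all: by end_near. Qed.

(** * Second moments of linear combinations *)

Section moments.
Context {d : measure_display} {Y : measurableType d} {R : realType}.
Variable P : probability Y R.

Definition lincomb m n (A : 'M[R]_(m, n)) (X : 'I_n -> Y -> R) (i : 'I_m) :
  Y -> R := fun y => \sum_l A i l * X l y.

Definition moment m n (X : 'I_m -> Y -> R) (Z : 'I_n -> Y -> R) :
    'M[R]_(m, n) :=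
  \matrix_(i, j) fine 'E_P[X i \* Z j]%E.

Lemma integrable_lincomb m n (A : 'M[R]_(m, n)) (X : 'I_n -> Y -> R) i :
  (forall l, P.-integrable setT (EFin \o X l)) ->
  P.-integrable setT (EFin \o lincomb A X i).
Proof.
move=> iX.
rewrite (_ : _ \o _ = fun y => (\sum_l (A i l)%:E * (X l y)%:E)%E); last first.
  by apply/funext => y /=; rewrite /lincomb -sumEFin.
by apply: integrable_sum => // l _; exact: (integrableZl measurableT _ (iX l)).
Qed.

Lemma expectation_lincomb m n (A : 'M[R]_(m, n)) (X : 'I_n -> Y -> R) i :
  (forall l, P.-integrable setT (EFin \o X l)) ->
  fine 'E_P[lincomb A X i]%E = \sum_l A i l * fine 'E_P[X l]%E.
Proof.
move=> iX; rewrite unlock.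
have -> : (\int[P]_y (lincomb A X i y)%:E =
    \int[P]_y (\sum_l (A i l)%:E * (X l y)%:E))%E.
  by apply: eq_integral => y _; rewrite /lincomb -sumEFin.
rewrite integral_sum// => [|l]; last exact: (integrableZl measurableT _ (iX l)).
rewrite (_ : (\sum_l _)%E = (\sum_l A i l * fine (\int[P]_y (X l y)%:E))%:E)//.
rewrite -sumEFin; apply: eq_bigr => l _.
rewrite (integralZl measurableT (iX l)) EFinM fineK//.
exact: (integrable_fin_num measurableT (iX l)).
Qed.

Lemma tr_moment m n (X : 'I_m -> Y -> R) (Z : 'I_n -> Y -> R) :
  (moment X Z)^T = moment Z X.
Proof.
apply/matrixP => i j; rewrite !mxE; congr (fine 'E_P[_]%E).
by apply/funext => y /=; rewrite mulrC.
Qed.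

Lemma moment_lincombl m n q (A : 'M[R]_(m, n)) (X : 'I_n -> Y -> R)
    (Z : 'I_q -> Y -> R) :
  (forall l j, P.-integrable setT (EFin \o (X l \* Z j))) ->
  moment (lincomb A X) Z = A *m moment X Z.
Proof.
move=> iXZ; apply/matrixP => i j; rewrite !mxE.
rewrite (_ : _ \* _ = lincomb A (fun l => X l \* Z j) i).
  by rewrite expectation_lincomb//; apply: eq_bigr => l _; rewrite mxE.
apply/funext => y /=; rewrite /lincomb mulr_suml.
by apply: eq_bigr => l _; rewrite mulrA.
Qed.

Lemma moment_lincombr m n q (B : 'M[R]_(q, n)) (X : 'I_m -> Y -> R)
    (Z : 'I_n -> Y -> R) :
  (forall i l, P.-integrable setT (EFin \o (X i \* Z l))) ->
  moment X (lincomb B Z) = moment X Z *m B^T.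
Proof.
move=> iXZ; rewrite -[LHS]trmxK tr_moment moment_lincombl.
  by rewrite trmx_mul tr_moment.
move=> l i; rewrite (_ : _ \o _ = EFin \o (X i \* Z l)) //.
by apply/funext => y /=; rewrite mulrC.
Qed.

Lemma moment_lincomb m n q r (A : 'M[R]_(m, n)) (B : 'M[R]_(q, r))
    (X : 'I_n -> Y -> R) (Z : 'I_r -> Y -> R) :
  (forall i j, P.-integrable setT (EFin \o (X i \* Z j))) ->
  moment (lincomb A X) (lincomb B Z) = A *m moment X Z *m B^T.
Proof.
move=> iXZ; rewrite moment_lincombr ?moment_lincombl// => i l.
rewrite (_ : _ \* _ = lincomb A (fun h => X h \* Z l) i); last first.
  apply/funext => y /=; rewrite /lincomb mulr_suml.
  by apply: eq_bigr => h _; rewrite mulrA.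
exact: integrable_lincomb.
Qed.

(** u N u^t is the second moment of the random variable u X. *)
Lemma moment_psd n (X : 'I_n -> Y -> R) (u : 'rV[R]_n) :
  (forall i j, P.-integrable setT (EFin \o (X i \* X j))) ->
  0 <= (u *m moment X X *m u^T) 0 0.
Proof.
move=> iX; rewrite -moment_lincomb// mxE fine_ge0//.
by apply: expectation_ge0 => y /=; exact: sqr_ge0.
Qed.

Lemma lincomb_mean0 m n (A : 'M[R]_(m, n)) (X : 'I_n -> Y -> R) i :
  (forall l, P.-integrable setT (EFin \o X l)) ->
  (forall l, 'E_P[X l]%E = 0%E) -> 'E_P[lincomb A X i]%E = 0%E.
Proof.
move=> iX EX; rewrite -[LHS]fineK; last first.
  by rewrite unlock integrable_fin_num//; exact: (integrable_lincomb _ _ iX).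
by rewrite expectation_lincomb// big1// => l _; rewrite EX mulr0.
Qed.

Lemma covariance_centered (X Z : Y -> R) :
  'E_P[X]%E = 0%E -> 'E_P[Z]%E = 0%E -> covariance P X Z = 'E_P[X \* Z]%E.
Proof.
move=> EX EZ; rewrite covariance.unlock EX EZ/=; congr expectation.
by apply/funext => y; rewrite !fctE/= !subr0.
Qed.

Lemma Lfun2_integrableM (X Z : Y -> R) :
  X \in Lfun P 2%:E -> Z \in Lfun P 2%:E ->
  P.-integrable setT (EFin \o (X \* Z)).
Proof. by move=> X2 Z2; exact/Lfun1_integrable/Lfun2_mul_Lfun1. Qed.

Lemma Lfun2_integrable (X : Y -> R) :
  X \in Lfun P 2%:E -> P.-integrable setT (EFin \o X).
Proof.
move=> X2; apply/Lfun1_integrable; apply: Lfun_subset12 => //.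
by rewrite fin_num_measure.
Qed.

End moments.

(** * Scores and the identity C = - E(dg) *)

Section models.
Context {d : measure_display} {Y : measurableType d} {R : realType} {k : nat}.
Variables (mu : {measure set Y -> \bar R}) (M : set (probability Y R)).
Variables (p : probability Y R -> Y -> R).
Hypothesis pdens : is_density mu M p.
Hypothesis psupp : common_support M p.
Implicit Types (c : chart Y R k) (P : probability Y R).
Implicit Types (g : probability Y R -> Y -> 'cV[R]_k).

Definition est_deriv c g P (i j : 'I_k) (y : Y) : R :=
  pderiv (fun x => gcomp g (chart_label c x) i y) j (chart_coord c P).

Lemma near_chart_coord c (Q : 'rV[R]_k -> Prop) P :
  global_parameterization M c -> M P ->
  (forall x, chart_dom c x -> Q x) -> \forall x \near chart_coord c P, Q x.
Proof.
move=> gp MP UQ; apply: filterS UQ _; apply: open_nbhs_nbhs; split.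
  exact: (dom_open gp).
exact: (coord_dom gp MP).
Qed.

Lemma density_off_support P Q y : M P -> M Q -> ~ 0 < p P y -> p Q y = 0.
Proof.
move=> MP MQ nP; apply/eqP; rewrite eq_le; have [_ -> _] := pdens MQ.
rewrite andbT leNgt; apply/negP => /(psupp MQ MP y).1; exact: nP.
Qed.

Lemma score_off_support c P y j :
  global_parameterization M c -> M P -> ~ 0 < p P y -> score p c P j y = 0.
Proof.
move=> gp MP nP; apply: pderiv_near0; apply: (near_chart_coord gp MP) => x Ux.
by rewrite /loglik (density_off_support MP (label_in gp Ux) nP) ln0.
Qed.

Section information_identity.
Variables (c : chart Y R k) (g : probability Y R -> Y -> 'cV[R]_k).
Hypothesis reg : regular_model mu M p c.
Hypothesis est : generalized_estimator mu M p c g.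

Let gp := model_param reg.

Lemma measurable_estimator P i : M P -> measurable_fun setT (gcomp g P i).
Proof.
move=> MP.
by have /integrableP[/measurable_EFinP] := Lfun2_integrable (est_L2 est i MP).
Qed.

Lemma measurable_score P j : M P -> measurable_fun setT (score p c P j).
Proof.
move=> MP.
by have /integrableP[/measurable_EFinP] := Lfun2_integrable (score_L2 reg j MP).
Qed.

Lemma measurable_est_deriv P i j :
  M P -> measurable_fun setT (est_deriv c g P i j).
Proof.
move=> MP; have Ux := coord_dom gp MP.
apply: (@measurable_pderiv _ _ _ _ (chart_dom c)
  (fun x => gcomp g (chart_label c x) i)) => //.
- exact: (dom_open gp).
- by move=> z Uz; apply: measurable_estimator; exact: (label_in gp Uz).
- move=> y; apply: diff_derivable.
  exact: (smooth_on_differentiable (est_smooth est y i) Ux).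
Qed.

Lemma integral_estimator_density P i : M P ->
  \int[mu]_y (gcomp g P i y * p P y) = 0.
Proof.
move=> MP; have [mp p0 pE] := pdens MP; rewrite /Rintegral.
rewrite -(integral_density mp p0 pE (measurable_estimator i MP)).
by have := est_mean0 est i MP; rewrite unlock => ->.
Qed.

(** On the support this is the product rule with p = exp(l). Off the support the
    density vanishes for all parameters, so both sides are 0. *)
Lemma pderiv_estimator_density P i j y : M P ->
  pderiv (fun x => gcomp g (chart_label c x) i y * p (chart_label c x) y) j
    (chart_coord c P) =
  (est_deriv c g P i j y + gcomp g P i y * score p c P j y) * p P y.
Proof.
move=> MP; have Ux := coord_dom gp MP.
have [Py|nPy] := pselect (0 < p P y); last first.
  rewrite (density_off_support MP MP nPy) mulr0; apply: pderiv_near0.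
  apply: (near_chart_coord gp MP) => x Vx.
  by rewrite (density_off_support MP (label_in gp Vx) nPy) mulr0.
have pE x : chart_dom c x -> p (chart_label c x) y = expR (loglik p c y x).
  by move=> Vx; rewrite lnK// posrE; exact/(psupp MP (label_in gp Vx) y).
rewrite (@pderiv_near _ _ _ (fun x => gcomp g (chart_label c x) i y *
    expR (loglik p c y x))); last first.
  by apply: (near_chart_coord gp MP) => x Vx; rewrite pE.
rewrite pderiv_mul_expR.
- by rewrite -pE// (coordK gp MP).
- exact: (smooth_on_differentiable (est_smooth est y i) Ux).
- exact: (smooth_on_differentiable (loglik_smooth reg MP Py) Ux).
Qed.

Lemma integrable_est_score P i j : M P ->
  P.-integrable setT (EFin \o (gcomp g P i \* score p c P j)).
Proof.
move=> MP; apply: Lfun2_integrableM; first exact: (est_L2 est i MP).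
exact: (score_L2 reg j MP).
Qed.

(** Differentiation under the integral sign makes (d_j g_i + g_i d_j l) p
    integrable against mu, and the product of square-integrable functions
    g_i d_j l is P-integrable: the difference is integrable. *)
Lemma integrable_est_deriv P i j : M P ->
  P.-integrable setT (EFin \o est_deriv c g P i j).
Proof.
move=> MP; have [mp p0 pE] := pdens MP.
have [/= idh _ _] := est_diff_under est i j MP.
have igs := density_integrable mp p0 pE (integrable_est_score i j MP).
apply: (integrable_density mp p0 pE (measurable_est_deriv i j MP)).
have := integrableB measurableT idh igs.
apply: eq_integrable => // y _ /=.
by rewrite pderiv_estimator_density// -EFinB -mulrBl addrK.
Qed.

(** The integral of g_i p against mu is 0 at every parameter near that of P, so
    its derivative, which is E(d_j g_i + g_i d_j l), vanishes. *)
Lemma integral_est_deriv_score P i j : M P ->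
  fine 'E_P[gcomp g P i \* score p c P j]%E =
  - fine 'E_P[est_deriv c g P i j]%E.
Proof.
move=> MP; have [mp p0 pE] := pdens MP.
have [/= _ _ dh] := est_diff_under est i j MP.
have : \int[P]_y (est_deriv c g P i j y + gcomp g P i y * score p c P j y) = 0.
  rewrite /Rintegral (integral_density mp p0 pE); last first.
    apply: measurable_funD; first exact: measurable_est_deriv.
    apply: measurable_funM; first exact: measurable_estimator.
    exact: measurable_score.
  rewrite -/(Rintegral _ _ _).
  under eq_Rintegral do rewrite -pderiv_estimator_density//.
  rewrite -dh; apply: pderiv_near0; apply: (near_chart_coord gp MP) => x Ux.
  exact: (integral_estimator_density i (label_in gp Ux)).
rewrite RintegralD//; last 2 first.
- exact: integrable_est_deriv.
- exact: integrable_est_score.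
by rewrite unlock => /eqP; rewrite addrC addr_eq0 => /eqP.
Qed.

Lemma crosscov_moment P : M P ->
  crosscov p c g P = moment P (gcomp g P) (score p c P).
Proof.
move=> MP; apply/matrixP => i j; rewrite !mxE covariance_centered//.
  exact: (est_mean0 est i MP).
exact: (score_mean0 reg j MP).
Qed.

Lemma crosscov_mean_deriv P : M P -> crosscov p c g P = - mean_deriv c g P.
Proof.
move=> MP; rewrite crosscov_moment//; apply/matrixP => i j; rewrite !mxE.
exact: integral_est_deriv_score.
Qed.

End information_identity.
End models.

(** * Change of frame and change of chart *)

Section charts.
Context {d : measure_display} {Y : measurableType d} {R : realType} {k : nat}.
Variables (mu : {measure set Y -> \bar R}) (M : set (probability Y R)).
Variables (p : probability Y R -> Y -> R) (theta : chart Y R k).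
Variable (g : probability Y R -> Y -> 'cV[R]_k).
Hypothesis reg : regular_model mu M p theta.
Hypothesis est : generalized_estimator mu M p theta g.
Implicit Types (P : probability Y R).

Let pdens := model_density reg.
Let psupp := model_support reg.
Let gp := model_param reg.

Lemma covmx_moment P : M P -> covmx g P = moment P (gcomp g P) (gcomp g P).
Proof.
move=> MP; apply/matrixP => i j; rewrite !mxE covariance_centered//.
  exact: (est_mean0 est i MP).
exact: (est_mean0 est j MP).
Qed.

Lemma integrable_est2 P i j : M P ->
  P.-integrable setT (EFin \o (gcomp g P i \* gcomp g P j)).
Proof.
move=> MP; apply: Lfun2_integrableM; first exact: (est_L2 est i MP).
exact: (est_L2 est j MP).
Qed.

Lemma integrable_score2 P i j : M P ->
  P.-integrable setT (EFin \o (score p theta P i \* score p theta P j)).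
Proof.
move=> MP; apply: Lfun2_integrableM; first exact: (score_L2 reg i MP).
exact: (score_L2 reg j MP).
Qed.

Lemma Lambda_mulmx (A : 'rV[R]_k -> 'M[R]_k) P : M P ->
  A (chart_coord theta P) \in unitmx ->
  Lambda p theta (fun Q y => A (chart_coord theta Q) *m g Q y) P =
  Lambda p theta g P.
Proof.
move=> MP; set B := A _ => Bu.
set g' := fun Q y => _.
have g'E : gcomp g' P = lincomb B (gcomp g P).
  by apply/funext => i; apply/funext => y; rewrite /gcomp mxE.
have Eg' i : 'E_P[gcomp g' P i]%E = 0%E.
  rewrite g'E; apply: lincomb_mean0 => l; last exact: (est_mean0 est l MP).
  exact: (Lfun2_integrable (est_L2 est l MP)).
have CE : crosscov p theta g' P = B *m crosscov p theta g P.
  rewrite (crosscov_moment reg est MP) -moment_lincombl; last first.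
    by move=> l j; exact: (integrable_est_score reg est).
  rewrite -g'E; apply/matrixP => i j; rewrite !mxE covariance_centered//.
  exact: (score_mean0 reg j MP).
have VE : covmx g' P = B *m covmx g P *m B^T.
  rewrite (covmx_moment MP) -moment_lincomb; last first.
    by move=> l j; exact: integrable_est2.
  by rewrite -g'E; apply/matrixP => i j; rewrite !mxE covariance_centered.
rewrite /Lambda CE VE.
have Vu := est_covmx_unit est MP.
rewrite !invmx_mul ?unitmx_mul ?unitmx_tr ?Bu ?Vu//.
rewrite trmx_mul !mulmxA mulmxK ?unitmx_tr//.
by rewrite mulmxKV.
Qed.

Section reparameterization.
Variables (xi : chart Y R k) (tau : 'rV[R]_k -> 'rV[R]_k).
Hypothesis rep : reparameterization M theta xi tau.
Variable P : probability Y R.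
Hypothesis MP : M P.

Let transition x := chart_coord theta (chart_label xi x).
Let x' := chart_coord xi P.
Let J := change_jacobian theta xi P.

Let gpxi : global_parameterization M xi. Proof. by case: rep. Qed.

Lemma transition_coord : transition x' = chart_coord theta P.
Proof. by rewrite /transition /x' (coordK gpxi). Qed.

(** On the open domain of xi, the transition map coincides with the smooth left
    inverse of tau. *)
Lemma differentiable_transition : differentiable transition x'.
Proof.
have [_ [_ _ _ _ [h sh hK]] xiE] := rep.
apply: (near_eq_differentiable (f := h)); last first.
  exact: (smooth_map_on_differentiable sh (coord_dom gpxi MP)).
apply: (near_chart_coord gpxi MP) => x Vx.
have MQ := label_in gpxi Vx.
rewrite /transition -{1}(labelK gpxi Vx) xiE// hK//.
exact: (coord_dom gp MQ).
Qed.

(** The transition map after tau is the identity on the domain of theta, so the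
    Jacobian of tau inverts that of the transition map. *)
Lemma change_jacobian_unit : J \in unitmx.
Proof.
have [_ [_ _ _ stau _] xiE] := rep.
have x'E : x' = tau (chart_coord theta P) by rewrite /x' xiE.
have /mulmx1_unit[_] : 'J tau (chart_coord theta P) *m 'J transition x' = 1%:M.
  rewrite x'E; apply: jacobian_left_inverse.
  - exact: (smooth_map_on_differentiable stau (coord_dom gp MP)).
  - by rewrite -x'E; exact: differentiable_transition.
  apply: (near_chart_coord gp MP) => z Uz; have MQ := label_in gp Uz.
  rewrite /transition -{1}(labelK gp Uz) -xiE//.
  by rewrite (coordK gpxi MQ) (labelK gp Uz).
by rewrite -unitmx_tr.
Qed.

Lemma pderiv_chart (f : probability Y R -> R) j :
  differentiable (fun x => f (chart_label theta x)) (chart_coord theta P) ->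
  pderiv (fun x => f (chart_label xi x)) j x' =
  \sum_l J^T j l *
    pderiv (fun x => f (chart_label theta x)) l (chart_coord theta P).
Proof.
rewrite -transition_coord trmxK => df.
rewrite -(pderiv_comp _ differentiable_transition df).
apply: pderiv_near; apply: (near_chart_coord gpxi MP) => x Vx /=.
by rewrite /transition (coordK gp (label_in gpxi Vx)).
Qed.

(** On the support this is the chain rule. Off the support the log-likelihood is
    constant in the parameter, in either chart, and both scores are 0. *)
Lemma score_chart : score p xi P = lincomb J^T (score p theta P).
Proof.
apply/funext => j; apply/funext => y; rewrite /lincomb.
have [Py|nPy] := pselect (0 < p P y).
  apply: (@pderiv_chart (fun Q => ln (p Q y))).
  exact: (smooth_on_differentiable (loglik_smooth reg MP Py) (coord_dom gp MP)).
rewrite (score_off_support pdens psupp _ gpxi)// big1// => l _.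
by rewrite (score_off_support pdens psupp _ gp)// mulr0.
Qed.

Lemma est_deriv_chart i :
  est_deriv xi g P i = lincomb J^T (est_deriv theta g P i).
Proof.
apply/funext => j; apply/funext => y; rewrite /lincomb.
apply: (@pderiv_chart (fun Q => gcomp g Q i y)).
exact: (smooth_on_differentiable (est_smooth est y i) (coord_dom gp MP)).
Qed.

Lemma crosscov_chart : crosscov p xi g P = crosscov p theta g P *m J.
Proof.
rewrite (crosscov_moment reg est MP) -[J in RHS]trmxK -moment_lincombr;
  last first.
  by move=> i l; exact: (integrable_est_score reg est).
have Es j : 'E_P[score p xi P j]%E = 0%E.
  rewrite score_chart; apply: lincomb_mean0 => l; last first.
    exact: (score_mean0 reg l MP).
  exact: (Lfun2_integrable (score_L2 reg l MP)).
rewrite -score_chart; apply/matrixP => i j; rewrite !mxE covariance_centered//.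
exact: (est_mean0 est i MP).
Qed.

Lemma mean_deriv_chart : mean_deriv xi g P = mean_deriv theta g P *m J.
Proof.
apply/matrixP => i j; rewrite !mxE -/(est_deriv xi g P i j) est_deriv_chart.
rewrite expectation_lincomb; last first.
  by move=> l; exact: (integrable_est_deriv pdens psupp reg est).
by apply: eq_bigr => l _; rewrite !mxE mulrC.
Qed.

Lemma fisher_chart : fisher p xi P = J^T *m fisher p theta P *m J.
Proof.
rewrite -[LHS]/(moment P (score p xi P) (score p xi P)) score_chart.
by rewrite moment_lincomb ?trmxK// => i j; exact: integrable_score2.
Qed.

Lemma Lambda_chart : Lambda p xi g P = J^T *m Lambda p theta g P *m J.
Proof. by rewrite /Lambda crosscov_chart trmx_mul !mulmxA. Qed.

Lemma Eff_chart :
  exists2 B, B \in unitmx & Eff p xi g P = B *m Eff p theta g P *m invmx B.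
Proof.
have Fu := fisher_unit reg MP.
have Ju := change_jacobian_unit.
have s2 i j := integrable_score2 i j MP.
have FT : (fisher p theta P)^T = fisher p theta P by exact: tr_moment.
have Fpos (u : 'rV[R]_k) : 0 <= (u *m fisher p theta P *m u^T) 0 0.
  exact: (moment_psd u s2).
have [Su SS] := invsqrtmxP FT Fpos Fu.
have [||| Su' SS'] := @invsqrtmxP _ _ (fisher p xi P).
- exact: tr_moment.
- move=> u; have := Fpos (u *m J^T).
  by rewrite trmx_mul (trmxK J) fisher_chart !mulmxA.
- by rewrite fisher_chart !unitmx_mul unitmx_tr Ju Fu.
rewrite /Eff Lambda_chart; apply: (congruence_similar _ Fu Ju Su Su' SS).
by rewrite SS' fisher_chart.
Qed.

End reparameterization.
End charts.

Unset Implicit Arguments.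

Theorem lemma2 (d : measure_display) (Y : measurableType d) (R : realType)
    (k : nat) (mu : {measure set Y -> \bar R}) (M : set (probability Y R))
    (p : probability Y R -> Y -> R) (theta : chart Y R k)
    (g : probability Y R -> Y -> 'cV[R]_k) :
  regular_model mu M p theta ->
  generalized_estimator mu M p theta g ->
  (forall P, M P -> crosscov p theta g P = - mean_deriv theta g P) /\
  (forall A : 'rV[R]_k -> 'M[R]_k,
    (forall x, chart_dom theta x -> A x \in unitmx) ->
    forall P, M P ->
      Lambda p theta (fun Q y => A (chart_coord theta Q) *m g Q y) P =
      Lambda p theta g P) /\
  (forall (xi : chart Y R k) (tau : 'rV[R]_k -> 'rV[R]_k),
    reparameterization M theta xi tau ->
    forall P, M P ->
      let J := change_jacobian theta xi P in
      crosscov p xi g P = - mean_deriv xi g P /\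
      Lambda p xi g P = J^T *m Lambda p theta g P *m J /\
      fisher p xi P = J^T *m fisher p theta P *m J /\
      char_poly (Eff p xi g P) = char_poly (Eff p theta g P) /\
      (forall a : R, eigenvalue (Eff p xi g P) a =
                     eigenvalue (Eff p theta g P) a) /\
      \tr (Eff p xi g P) = \tr (Eff p theta g P)).
Proof.
move=> reg est.
have CmD P : M P -> crosscov p theta g P = - mean_deriv theta g P.
  exact: (crosscov_mean_deriv (model_density reg) (model_support reg) reg est).
split; first exact: CmD.
split=> [A Au P MP|xi tau rep P MP J].
  apply: (Lambda_mulmx reg est) => //; apply: Au.
  exact: (coord_dom (model_param reg) MP).
have [B Bu /(similar_spectrum Bu)[chE eigE trE]] := Eff_chart reg est rep MP.
split.
  rewrite (crosscov_chart reg est rep MP) (mean_deriv_chart reg est rep MP).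
  by rewrite (CmD P MP); exact: mulNmx.
split; first exact: (Lambda_chart reg est rep MP).
split; first exact: (fisher_chart reg rep MP).
split; first exact: chE.
split; [exact: eigE|exact: trE].
Qed.
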